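(* The \textsc{Odd $2$-Coloring} problem can be solved in polynomial time.
   Context: All graphs are finite, simple and undirected. A graph is called odd if every vertex has odd degree (the empty graph is odd). The \textsc{Odd $2$-Coloring} problem is: given a graph $G$, determine whether $V(G)$ can be partitioned into two (possibly empty) sets $V_1,V_2$ such that both induced subgraphs $G[V_1]$ and $G[V_2]$ are odd. *)

(* Defs.v *)
From mathcomp Require Import all_boot all_order all_algebra.

Set Implicit Arguments.
Unset Strict Implicit.
Unset Printing Implicit Defensive.

Record sgraph := SGraph {
  vertex :> finType;
  adj : rel vertex;
  adj_sym : symmetric adj;
  adj_irr : irreflexive adj }.

Definition deg (G : sgraph) (x : G) : nat := #|[set y | adj x y]|.

Definition odd_graph (G : sgraph) : Prop := forall x : G, odd (deg x).

Section Induced.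
Variables (G : sgraph) (S : {set G}).

Definition induced_adj : rel {x : G | x \in S} :=
  fun u v => adj (val u) (val v).

Lemma induced_adj_sym : symmetric induced_adj.
Proof. by move=> u v; apply: adj_sym. Qed.

Lemma induced_adj_irr : irreflexive induced_adj.
Proof. by move=> u; apply: adj_irr. Qed.

Definition induced : sgraph := SGraph induced_adj_sym induced_adj_irr.

End Induced.

Definition odd_2_colorable (G : sgraph) : Prop :=
  exists V1 V2 : {set G},
    [/\ V1 :|: V2 = [set: G], V1 :&: V2 = set0,
        odd_graph (induced V1) & odd_graph (induced V2)].

(** The unit-cost RAM of Cook and Reckhow, over the natural numbers.  There is
    no multiplication or shift: starting from a word of bits, [t] steps only
    produce numbers of [O(t + log (size w))] bits, so that polynomial time on
    this machine is polynomial time on a Turing machine.  Registers are kept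
    apart from the indirectly addressed memory.  Register names, constants and
    jump targets are part of the program text; in particular a program only
    mentions finitely many registers. *)

Inductive instr :=
  | Iconst of nat & nat        (* r_i <- c *)
  | Iadd of nat & nat & nat    (* r_i <- r_j + r_k *)
  | Isub of nat & nat & nat    (* r_i <- r_j - r_k, truncated at 0 *)
  | Iread of nat & nat         (* r_i <- mem[r_j] *)
  | Iwrite of nat & nat        (* mem[r_i] <- r_j *)
  | Ijpos of nat & nat.        (* if r_i > 0 goto instruction l *)

Definition program := seq instr.

Record config := Config {
  pc : nat;
  regs : nat -> nat;
  mem : nat -> nat }.

Definition upd (f : nat -> nat) (i v : nat) : nat -> nat :=
  fun j => if j == i then v else f j.

Definition exec (a : instr) (c : config) : config :=
  let: Config l r m := c in
  match a with
  | Iconst i v => Config l.+1 (upd r i v) m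
  | Iadd i j k => Config l.+1 (upd r i (r j + r k)) m
  | Isub i j k => Config l.+1 (upd r i (r j - r k)) m
  | Iread i j => Config l.+1 (upd r i (m (r j))) m
  | Iwrite i j => Config l.+1 r (upd m (r i) (r j))
  | Ijpos i l' => Config (if 0 < r i then l' else l.+1) r m
  end.

(* The machine halts when the program counter leaves the program. *)
Definition halted (P : program) (c : config) : bool := size P <= pc c.

Definition step (P : program) (c : config) : config :=
  if onth P (pc c) is Some a then exec a c else c.

(* The input word is stored bit by bit from address 0 on, its length is in
   register 0, and everything else is 0. *)
Definition init (w : bitseq) : config :=
  Config 0 (upd (fun=> 0) 0 (size w)) (fun i => nat_of_bool (nth false w i)).

Definition accepting (c : config) : bool := 0 < regs c 0.

(* [L] is the set of yes-instances; the machine is only constrained on words of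
   the form [enc x]. *)

Definition polytime_decidable (I : Type) (enc : I -> bitseq) (L : I -> Prop) :=
  exists (P : program) (p : {poly nat}), forall x : I,
    exists2 t : nat, t <= (p.[size (enc x)])%R &
      let c := iter t (step P) (init (enc x)) in
      halted P c /\ (accepting c <-> L x).

(* The adjacency matrix, row by row: a word of length #|G| ^ 2. *)
Definition encode (G : sgraph) : bitseq :=
  [seq adj x y | x <- enum G, y <- enum G].

(* Main.v *)
Require Import Defs.
From mathcomp Require Import all_boot all_order all_algebra zify.

Set Implicit Arguments.
Unset Strict Implicit.
Unset Printing Implicit Defensive.

(** Over F_2, a 2-colouring x is odd on both sides iff every vertex u satisfies
    sum_(v ~ u) (1 + x_u + x_v) = 1, that is
    deg(u) x_u + sum_(v ~ u) x_v = 1 + deg(u): a linear system whose matrix is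
    the Laplacian.  It is solved by Gaussian elimination, one row at a time: a
    row with a 1 in column j is added to all later rows with a 1 in column j,
    after which x_j is free to satisfy it; a zero row must have right-hand side
    0.  The elimination is a branch-free program whose only control structure
    is the bounded loop; such programs compile to the RAM, and they run in
    polynomial time because their loop bounds are never overwritten. *)

(** * Bounded-loop programs and their compilation *)

(* L is the length n^2 of the input and the address of the matrix, S = n + 1 its
   row stride; P and Q hold addresses of rows, Pc and Qc of cells; I, J, K and H
   are loop counters. *)
Notation rL := 0 (only parsing).
Notation rTmp := 1 (only parsing).
Notation rOne := 2 (only parsing).
Notation rN := 3 (only parsing).
Notation rS := 4 (only parsing).
Notation rZero := 5 (only parsing).
Notation rTwo := 6 (only parsing).
Notation rOdd := 7 (only parsing).
Notation rRem := 8 (only parsing).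
Notation rG := 9 (only parsing).
Notation rSrc := 10 (only parsing).
Notation rDst := 11 (only parsing).
Notation rDiag := 12 (only parsing).
Notation rDeg := 13 (only parsing).
Notation rV := 14 (only parsing).
Notation rW := 15 (only parsing).
Notation rP := 16 (only parsing).
Notation rRej := 17 (only parsing).
Notation rFound := 18 (only parsing).
Notation rCol := 19 (only parsing).
Notation rA := 20 (only parsing).
Notation rF := 21 (only parsing).
Notation rQ := 22 (only parsing).
Notation rM := 23 (only parsing).
Notation rPc := 24 (only parsing).
Notation rQc := 25 (only parsing).
Notation rI := 26 (only parsing).
Notation rJ := 27 (only parsing).
Notation rK := 28 (only parsing).
Notation rH := 29 (only parsing).

Definition state := ((nat -> nat) * (nat -> nat))%type.

Definition at_pc (l : nat) (s : state) : config := Config l s.1 s.2.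

Definition ieval (a : instr) (s : state) : state :=
  let c := exec a (at_pc 0 s) in (regs c, Defs.mem c).

Definition straight (a : instr) : bool := if a is Ijpos _ _ then false else true.

Inductive cmd :=
  | Prim of instr
  | Seq of cmd & cmd
  | For of nat & nat & cmd.

(** The write to [rTmp] is included so that [den] gives the exact state of the compiled code,
    scratch register and all. *)
Definition dec (i : nat) (s : state) : state :=
  ieval (Isub i i rTmp) (ieval (Iconst rTmp 1) s).

Lemma dec_regs i s x : i != rTmp ->
  (dec i s).1 x = if x == i then s.1 i - 1 else if x == rTmp then 1 else s.1 x.
Proof.
by move=> it; rewrite /dec /= /upd eqxx (negPf it); case: eqP.
Qed.

Arguments dec : simpl never.

(* The counter starts at the bound plus 1 since it is decremented before each
   exit test; the outermost dec belongs to the last, failing test. *)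
Fixpoint den (c : cmd) (s : state) : state :=
  match c with
  | Prim a => ieval a s
  | Seq c1 c2 => den c2 (den c1 s)
  | For i k b =>
      dec i (iter (s.1 k) (fun x => ieval (Iconst rTmp 1) (den b (dec i x)))
                  (ieval (Iadd i k rTmp) (ieval (Iconst rTmp 1) s)))
  end.

Fixpoint code_size (c : cmd) : nat :=
  match c with
  | Prim _ => 1
  | Seq c1 c2 => code_size c1 + code_size c2
  | For _ _ b => code_size b + 8
  end.

(** In a loop, offsets 2 to 4 decrement and test the counter, the body starts at offset 6, and the
    exit is offset [code_size b + 8]. A jump on [rTmp], which holds 1 there, is unconditional. *)
Fixpoint compile (l : nat) (c : cmd) : program :=
  match c with
  | Prim a => [:: a]
  | Seq c1 c2 => compile l c1 ++ compile (l + code_size c1) c2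
  | For i k b =>
      [:: Iconst rTmp 1; Iadd i k rTmp; Iconst rTmp 1; Isub i i rTmp;
          Ijpos i (l + 6); Ijpos rTmp (l + code_size b + 8)]
      ++ compile (l + 6) b ++ [:: Iconst rTmp 1; Ijpos rTmp (l + 2)]
  end.

Definition target (a : instr) : seq nat :=
  match a with
  | Iconst i _ | Iadd i _ _ | Isub i _ _ | Iread i _ => [:: i]
  | Iwrite _ _ | Ijpos _ _ => [::]
  end.

Fixpoint writes (c : cmd) : seq nat :=
  match c with
  | Prim a => target a
  | Seq c1 c2 => writes c1 ++ writes c2
  | For i _ b => [:: rTmp, i & writes b]
  end.

Fixpoint bounds (c : cmd) : seq nat :=
  match c with
  | Prim _ => [::]
  | Seq c1 c2 => bounds c1 ++ bounds c2
  | For _ k b => k :: bounds b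
  end.

Fixpoint wf (c : cmd) : bool :=
  match c with
  | Prim a => straight a
  | Seq c1 c2 => wf c1 && wf c2
  | For i k b => [&& i != rTmp, k != rTmp, i \notin writes b & wf b]
  end.

Lemma size_compile c l : size (compile l c) = code_size c.
Proof.
elim: c l => //= [c1 IH1 c2 IH2 | i k b IH] l.
  by rewrite size_cat IH1 IH2.
by rewrite size_cat IH /=; lia.
Qed.

Lemma ieval_frame a s x : x \notin target a -> (ieval a s).1 x = s.1 x.
Proof.
case: s => r m; case: a => [i v|i j k|i j k|i j|i j|i l] //=;
  by rewrite inE /upd => /negPf ->.
Qed.

Lemma den_frame c s x : x \notin writes c -> (den c s).1 x = s.1 x.
Proof.
elim: c s => [a|c1 IH1 c2 IH2|i k b IH] s; first exact: ieval_frame.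
  by rewrite /= mem_cat negb_or => /andP[h1 h2]; rewrite IH2 // IH1.
rewrite /writes -/writes !inE !negb_or => /and3P[xt xi xb].
rewrite [den _ _]/=.
have decE y : (dec i y).1 x = y.1 x.
  by rewrite /dec /= /upd (negPf xi) (negPf xt).
rewrite decE; elim: (s.1 k) => [|j IHj]; first by rewrite /= /upd (negPf xi) (negPf xt).
by rewrite iterS ieval_frame ?inE // IH // decE.
Qed.

Definition code_at (P : program) (l : nat) (Q : program) :=
  forall j, j < size Q -> onth P (l + j) = onth Q j.

Lemma code_at_cat P l Q1 Q2 :
  code_at P l (Q1 ++ Q2) -> code_at P l Q1 /\ code_at P (l + size Q1) Q2.
Proof.
move=> h; split=> j hj.
  by rewrite h ?size_cat ?ltn_addr // onth_cat hj.
rewrite -addnA h ?size_cat ?ltn_add2l // onth_cat ltnNge leq_addr /=.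
by rewrite addKn.
Qed.

(* 'X + 1 rather than 'X, since the stride n + 1 used as a loop bound can exceed
   the length n^2 of the input. *)
Fixpoint cost (c : cmd) : {poly nat} :=
  match c with
  | Prim _ => 1%R
  | Seq c1 c2 => (cost c1 + cost c2)%R
  | For _ _ b => (('X + 1) * (cost b + 5%:R) + 6%:R)%R
  end.

Definition reaches (P : program) (T : nat) (c c' : config) :=
  exists2 t, t <= T & iter t (step P) c = c'.

Lemma reaches_trans P T1 T2 c1 c2 c3 :
  reaches P T1 c1 c2 -> reaches P T2 c2 c3 -> reaches P (T1 + T2) c1 c3.
Proof.
move=> [t1 h1 e1] [t2 h2 e2]; exists (t2 + t1); first by rewrite addnC leq_add.
by rewrite iterD e1.
Qed.

Lemma reaches_le P T T' c c' : T <= T' -> reaches P T c c' -> reaches P T' c c'.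
Proof. by move=> h [t ht e]; exists t => //; apply: leq_trans h. Qed.

Lemma reaches_straight P l a s :
  onth P l = Some a -> straight a -> reaches P 1 (at_pc l s) (at_pc l.+1 (ieval a s)).
Proof. by move=> h sa; exists 1 => //=; rewrite /step /= h; case: a sa {h}. Qed.

Lemma reaches_jump P l i l' s :
  onth P l = Some (Ijpos i l') ->
  reaches P 1 (at_pc l s) (at_pc (if 0 < s.1 i then l' else l.+1) s).
Proof. by move=> h; exists 1 => //=; rewrite /step /= h. Qed.

(** Induction on [c]. An inner bound is not written in the enclosing loop either, so it keeps its
    value through all iterations and nesting merely multiplies costs. *)
Lemma compile_correct c P l s L :
  wf c -> (forall k, k \in bounds c -> k \notin writes c /\ s.1 k <= L.+1) ->
  code_at P l (compile l c) ->
  reaches P ((cost c).[L])%R (at_pc l s) (at_pc (l + code_size c) (den c s)).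
Proof.
elim: c l s => [a|c1 IH1 c2 IH2|i k b IH] l s.
- move=> /= wa _ /(_ 0 isT) /=; rewrite addn0 addn1 hornerC => h.
  exact: reaches_straight.
- move=> /= /andP[w1 w2] hb /code_at_cat[]; rewrite size_compile => h1 h2.
  rewrite hornerD addnA.
  apply: reaches_trans (IH1 l s w1 _ h1) (IH2 _ _ w2 _ h2) => x hx.
    have [] := hb x; first by rewrite mem_cat hx.
    by rewrite mem_cat negb_or => /andP[].
  have [] := hb x; first by rewrite mem_cat hx orbT.
  by rewrite mem_cat negb_or => /andP[n1 n2] ?; rewrite den_frame.
move=> /and4P[it kt ib wb] hb.
rewrite /compile -/compile catA => /code_at_cat[/code_at_cat[h1 h2] h3].
have {}h2 : code_at P (l + 6) (compile (l + 6) b) by [].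
rewrite size_cat size_compile /= in h3.
have s0 := h1 0 isT; have s1 := h1 1 isT; have s2 := h1 2 isT.
have s3 := h1 3 isT; have s4 := h1 4 isT; have s5 := h1 5 isT.
have s6 := h3 0 isT; have s7 := h3 1 isT.
rewrite /= ?addn0 in s0 s1 s2 s3 s4 s5 s6 s7.
have [knw kL] := hb k (mem_head _ _).
have : k \notin [:: rTmp, i & writes b] by exact: knw.
rewrite !inE !negb_or => /and3P[_ ki kb].
have ti : (rTmp == i) = false by rewrite eq_sym; apply/negbTE.
have head x : reaches P 3 (at_pc (l + 2) x)
    (at_pc (if 0 < (x.1 i).-1 then l + 6 else l + 5) (dec i x)).
  apply: (@reaches_trans _ 1 2); first exact: (reaches_straight _ s2).
  rewrite -addnS; apply: (@reaches_trans _ 1 1); first exact: (reaches_straight _ s3).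
  rewrite -addnS.
  have -> : (x.1 i).-1 = (dec i x).1 i by rewrite dec_regs // eqxx subn1.
  by have := reaches_jump (dec i x) s4; rewrite -addnS.
(* Each round takes 3 steps for the header, the body, and 2 steps to jump back; the final [4] is the
   failing header and the jump out. *)
have loop j x : x.1 i = j.+1 ->
    (forall k, k \in bounds b -> x.1 k <= L.+1) ->
    reaches P (j * ((cost b).[L]%R + 5) + 4) (at_pc (l + 2) x)
      (at_pc (l + code_size b + 8)
        (dec i (iter j (fun x => ieval (Iconst rTmp 1) (den b (dec i x))) x))).
  elim: j x => [|j IHj] x xi xb.
    apply: reaches_trans (head x) _; rewrite xi /=.
    by have := reaches_jump (dec i x) s5; rewrite {2}/dec /= /upd ti.
  rewrite iterSr mulSn -addnA.
  pose y := dec i x.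
  have hy k' : k' \in bounds b -> y.1 k' <= L.+1.
    move=> hk; have [] := hb k'; first by rewrite inE hk orbT.
    rewrite !inE !negb_or => /and3P[kt' ki' _] _.
    by rewrite /= /upd (negPf ki') (negPf kt'); apply: xb.
  have r2 : reaches P (cost b).[L]%R (at_pc (l + 6) y) (at_pc (l + 6 + code_size b) (den b y)).
    apply: IH => // k' hk; split; last exact: hy.
    by have [] := hb k'; rewrite ?inE ?hk ?orbT // !negb_or => /and3P[].
  pose z := ieval (Iconst rTmp 1) (den b y).
  have zE k' : k' \notin writes b -> k' != rTmp -> z.1 k' = y.1 k'.
    by move=> h h'; rewrite ieval_frame ?inE // den_frame.
  have r3 : reaches P 2 (at_pc (l + 6 + code_size b) (den b y)) (at_pc (l + 2) z).
    have -> : l + 6 + code_size b = l + (6 + code_size b) by rewrite addnA.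
    apply: (@reaches_trans _ 1 1); first exact: (reaches_straight _ s6).
    by have := reaches_jump z s7; rewrite addn1.
  have r4 : reaches P (j * ((cost b).[L]%R + 5) + 4) (at_pc (l + 2) z)
     (at_pc (l + code_size b + 8)
        (dec i (iter j (fun x => ieval (Iconst rTmp 1) (den b (dec i x))) z))).
    apply: IHj => [|k' hk].
      by rewrite zE // /y /= /upd eqxx (negPf it) xi /=; lia.
    have [] := hb k'; first by rewrite inE hk orbT.
    rewrite !inE !negb_or => /and3P[kt' ki' kb'] _.
    by rewrite zE //; apply: hy.
  have := reaches_trans (reaches_trans (reaches_trans (head x) _) r3) r4.
  rewrite xi /= => /(_ _ r2) H.
  apply: reaches_le H.
  by rewrite leq_add2r addnAC addnC.
(* These 2 steps and the 4 of the failing test make the 6 in [cost]. *)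
have r0 : reaches P 2 (at_pc l s)
    (at_pc (l + 2) (ieval (Iadd i k rTmp) (ieval (Iconst rTmp 1) s))).
  apply: (@reaches_trans _ 1 1); first exact: (reaches_straight _ s0).
  by have := reaches_straight (ieval (Iconst rTmp 1) s) s1 isT; rewrite -addnS addn1.
have := reaches_trans r0 (loop (s.1 k) _ _ _).
rewrite -[_ + 8]addnA => H; apply: reaches_le (H _ _).
- rewrite /cost -/cost hornerD hornerM !hornerD hornerX !hornerC.
  rewrite addnC -addnA; apply: (@leq_add _ _ ((L + 1) * (_ + 5)) 6) => //.
  by rewrite leq_mul2r addn1 kL orbT.
- by rewrite /= /upd !eqxx (negPf kt); lia.
move=> k' hk; have [] := hb k'; first by rewrite inE hk orbT.
rewrite !inE !negb_or => /and3P[kt' ki' kb'] h.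
by rewrite /= /upd (negPf ki') (negPf kt').
Qed.

(** Here [c1] may compute the loop bounds of [c2], which [compile_correct] forbids for the whole
    sequence; this is how [rN] and [rS] are obtained. *)
Lemma compile_seq_correct c1 c2 s L :
  wf c1 -> wf c2 ->
  (forall k, k \in bounds c1 -> k \notin writes c1 /\ s.1 k <= L.+1) ->
  (forall k, k \in bounds c2 -> k \notin writes c2 /\ (den c1 s).1 k <= L.+1) ->
  reaches (compile 0 (Seq c1 c2)) ((cost (Seq c1 c2)).[L])%R
    (at_pc 0 s) (at_pc (code_size (Seq c1 c2)) (den c2 (den c1 s))).
Proof.
move=> w1 w2 b1 b2; set P := compile 0 _.
have code : code_at P 0 P by [].
have [h1] := @code_at_cat P 0 (compile 0 c1) (compile (0 + code_size c1) c2) code.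
rewrite size_compile => h2; rewrite hornerD.
exact: reaches_trans (compile_correct w1 b1 h1) (compile_correct w2 b2 h2).
Qed.

Lemma accepting_at_pc l s : accepting (at_pc l s) = (0 < s.1 0).
Proof. by []. Qed.

Lemma halted_at_pc P l s : halted P (at_pc l s) = (size P <= l).
Proof. by []. Qed.

(** The invariant is indexed by the number of completed rounds. Its stability under changes of [i]
    and [rTmp] makes it immune to the loop control, and the body may assume that unwritten registers
    still have their initial values. *)
Lemma for_rule (I : nat -> state -> Prop) i k b s :
  (forall t s s', s'.2 = s.2 ->
     (forall x, x != i -> x != rTmp -> s'.1 x = s.1 x) -> I t s -> I t s') ->
  I 0 s ->
  (forall t s', t < s.1 k -> (forall x, x \notin writes (For i k b) -> s'.1 x = s.1 x) ->
     I t s' -> I t.+1 (den b s')) ->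
  I (s.1 k) (den (For i k b) s).
Proof.
move=> stable I0 step; rewrite [den _ _]/=.
have decP t y : I t y -> I t (dec i y).
  by apply: stable => // x xi xt; rewrite /dec /= /upd (negPf xi) (negPf xt).
apply: (decP); set s1 := ieval (Iadd _ _ _) _.
have frame1 x : x \notin writes (For i k b) -> s1.1 x = s.1 x.
  rewrite /writes -/writes !inE !negb_or => /and3P[xt xi xb].
  by rewrite /= /upd (negPf xi) (negPf xt).
suff: forall t, t <= s.1 k ->
  let y := iter t (fun x => ieval (Iconst rTmp 1) (den b (dec i x))) s1 in
  (forall x, x \notin writes (For i k b) -> y.1 x = s.1 x) /\ I t y.
  by move=> /(_ _ (leqnn _))[].
elim=> [|t IH] tk.
  by split=> //; apply: stable I0 => // x xi xt; rewrite /= /upd (negPf xi) (negPf xt).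
rewrite iterS; move: (iter _ _ _) (IH (ltnW tk)) => y [fr It] z.
have frd x : x \notin writes (For i k b) -> (dec i y).1 x = s.1 x.
  move=> xw; rewrite -fr //; move: xw.
  rewrite /writes -/writes !inE !negb_or => /and3P[xt xi xb].
  by rewrite /dec /= /upd (negPf xi) (negPf xt).
split=> [x xw|].
  rewrite -frd // /z; move: xw; rewrite /writes -/writes !inE !negb_or => /and3P[xt xi xb].
  by rewrite ieval_frame ?inE // den_frame.
apply: (stable _ (den b (dec i y))) => //; last by apply: step => //; apply: decP.
by move=> x xi xt; rewrite /= /upd (negPf xt).
Qed.

(** * The elimination program *)

(* row-major from address n^2, with the right-hand sides in column n *)
Definition stores (n : nat) (B : nat -> nat -> bool) (m : nat -> nat) : Prop :=
  forall q c, q < n -> c <= n -> m (n * n + q * n.+1 + c) = B q c.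

Lemma stores_ext n B B' m :
  (forall q c, q < n -> c <= n -> B q c = B' q c) -> stores n B m -> stores n B' m.
Proof. by move=> e h q c qn cn; rewrite h // e. Qed.

Lemma cell_inj n q c q' c' : c <= n -> c' <= n ->
  (q * n.+1 + c == q' * n.+1 + c') = (q == q') && (c == c').
Proof.
move=> cn cn'; apply/eqP/andP => [e|[/eqP-> /eqP->]//].
have eq : q = q'.
  by have := congr1 (fun x => x %/ n.+1) e; rewrite !divnMDl // !divn_small // !addn0.
by split; apply/eqP => //; move: e; rewrite eq => /addnI.
Qed.

Lemma stores_upd n B m q c (a v : nat) (b : bool) : c <= n ->
  a = n * n + q * n.+1 + c -> v = b -> stores n B m ->
  stores n (fun q' c' => if (q' == q) && (c' == c) then b else B q' c') (upd m a v).
Proof.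
move=> cn -> -> h q' c' qn cn'.
by rewrite /upd -!addnA eqn_add2l cell_inj //; case: ifP => // _; rewrite addnA h.
Qed.

Coercion Prim : instr >-> cmd.
Notation "c1 ;; c2" := (Seq c1 c2) (at level 60, right associativity).

(* Branch-free logic on bits, with truncated subtraction: x xor y is
   (x - y) + (y - x), x and y is x + y - 1, x and not y is x - y. *)

(* adds row P to row Q when M = 1 *)
Definition xor_row : cmd :=
  Iadd rPc rP rZero ;; Iadd rQc rQ rZero ;;
  For rH rS (
    Iread rV rPc ;; Iread rW rQc ;;
    Iadd rV rV rM ;; Isub rV rV rOne ;;
    Isub rA rV rW ;; Isub rW rW rV ;; Iadd rW rW rA ;;
    Iwrite rQc rW ;; Iadd rPc rPc rOne ;; Iadd rQc rQc rOne).

(* M := 1 exactly when F = 1, row Q lies below row P and has a 1 in column Col *)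
Definition multiplier : cmd :=
  Isub rG rQ rP ;; Isub rG rOne rG ;;
  Iadd rA rQ rCol ;; Iread rM rA ;; Iadd rM rM rF ;; Isub rM rM rOne ;; Isub rM rM rG.

(** All rows are visited; those not below row P get multiplier 0. *)
Definition elim_rows : cmd :=
  Iadd rQ rL rZero ;;
  For rK rN (multiplier ;; xor_row ;; Iadd rQ rQ rS).

(* F := 1 exactly at the first column with a 1 in row P *)
Definition test_column : cmd :=
  Iadd rA rP rCol ;; Iread rF rA ;; Isub rF rF rFound ;; Iadd rFound rFound rF.

Definition elim_pivot : cmd :=
  Iconst rFound 0 ;; Iconst rCol 0 ;;
  For rJ rN (test_column ;; elim_rows ;; Iadd rCol rCol rOne).

(** [rRej] grows exactly when row P has no pivot and right-hand side 1. *)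
Definition reject_row : cmd :=
  Iadd rA rP rN ;; Iread rF rA ;; Isub rF rF rFound ;; Iadd rRej rRej rF.

Definition elim_all : cmd :=
  Iadd rP rL rZero ;; Iconst rRej 0 ;;
  For rI rN (elim_pivot ;; reject_row ;; Iadd rP rP rS).

Definition ready (n : nat) (s : state) : Prop :=
  [/\ s.1 rL = n * n, s.1 rN = n, s.1 rS = n.+1, s.1 rOne = 1 & s.1 rZero = 0].

Lemma ready_frame n (W : seq nat) s s' :
  (forall x, x \notin W -> s'.1 x = s.1 x) ->
  all (fun x => x \notin W) [:: rL; rN; rS; rOne; rZero] -> ready n s -> ready n s'.
Proof. by move=> h /and5P[? ? ? ? /andP[? _]] [*]; split; rewrite h. Qed.

Lemma ready_den n c s :
  all (fun x => x \notin writes c) [:: rL; rN; rS; rOne; rZero] ->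
  ready n s -> ready n (den c s).
Proof. by apply: ready_frame => x; apply: den_frame. Qed.

Lemma xor_rowP n B p q (b : bool) s : p < n -> q < n -> ready n s ->
  s.1 rP = n * n + p * n.+1 -> s.1 rQ = n * n + q * n.+1 -> s.1 rM = b ->
  stores n B s.2 ->
  stores n (fun q' c => if q' == q then B q c (+) (b && B p c) else B q' c) (den xor_row s).2.
Proof.
move=> pn qn [e0 eN eS e1 eZ] eP eQ eM hB; rewrite /xor_row.
set loop := For _ _ _.
pose I t (s : state) := [/\ s.1 rPc = n * n + p * n.+1 + t, s.1 rQc = n * n + q * n.+1 + t &
   stores n (fun q' c => if (q' == q) && (c < t) then B q c (+) (b && B p c) else B q' c) s.2].
set s1 := den (Iadd rQc rQ rZero) (den (Iadd rPc rP rZero) s).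
suff [_ _ h] : I (s1.1 rS) (den loop s1).
  by apply: stores_ext h => q' c _ cn; rewrite /= /upd /= eS ltnS cn andbT.
apply: for_rule.
- by move=> t r r' e h [h1 h2 h3]; split; rewrite ?h ?e.
- split; rewrite /= /upd /= ?eZ ?eP ?eQ //.
  by apply: stores_ext hB => q' c _ _; rewrite andbF.
move=> t [r m] /=; rewrite /upd /= eS ltnS => tn fr [/= hP hQ hm].
have hM : r rM = b by rewrite fr.
have r1 : r rOne = 1 by rewrite fr.
split; rewrite /= /upd /= ?hP ?hQ ?r1 ?addn1 ?addnS //.
(* Only columns below [t] have changed, so both cells read still hold their values in [B], even if
   [p] is [q]. *)
rewrite -/(upd m _ _) !hm // hM ltnn !andbF.
have ev : B q t - (B p t + b - 1) + (B p t + b - 1 - B q t) = B q t (+) (b && B p t) :> nat.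
  by clear; case: (B p t) (B q t) b => [] [] [].
apply: stores_ext (stores_upd tn (erefl _) ev hm) => q' c _ cn.
case: (q' =P q) => //= ->; rewrite [c < t.+1]ltnS [c <= t]leq_eqVlt.
by case: (c =P t) => // ->.
Qed.

(** The row operation on the augmented matrix, column [n] included; it clears column [j] below row
    [p] when [B p j] holds. *)
Definition elim (B : nat -> nat -> bool) (p j q c : nat) : bool :=
  B q c (+) [&& p < q, B q j & B p c].

Lemma elim_rowsP n B p j (f : bool) s : p < n -> j < n -> ready n s ->
  s.1 rP = n * n + p * n.+1 -> s.1 rCol = j -> s.1 rF = f -> stores n B s.2 ->
  stores n (fun q c => if f then elim B p j q c else B q c) (den elim_rows s).2.
Proof.
move=> pn jn rs eP eC eF hB; case: (rs) => e0 eN eS e1 eZ.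
rewrite /elim_rows; set loop := For _ _ _; set s1 := ieval (Iadd rQ rL rZero) s.
(* The test [p < q] protects row [p], so every later row receives the original row [p]. *)
pose I t (s : state) := s.1 rQ = n * n + t * n.+1 /\
   stores n (fun q c => B q c (+) [&& q < t, f, p < q, B q j & B p c]) s.2.
suff [_ h] : I (s1.1 rN) (den loop s1).
  apply: stores_ext h => q c qn _; rewrite /= /upd /= eN qn /=.
  by case: f {eF I} => //; rewrite addbF.
apply: for_rule.
- by move=> t r r' e h [h1 h2]; split; rewrite ?h ?e.
- split; rewrite /= /upd /= ?e0 ?eZ //.
  by apply: stores_ext hB => q c _ _; rewrite addbF.
move=> t s2 tn fr [hQ hm].
have {}tn : t < n by move: tn; rewrite /= /upd /= eN.
have {}fr x : x \notin rQ :: writes loop -> s2.1 x = s.1 x.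
  by rewrite inE negb_or => /andP[/negPf xQ xw]; rewrite fr //= /upd xQ.
have r2 : ready n s2 by apply: ready_frame fr isT rs.
pose s3 := den multiplier s2; pose s4 := den xor_row s3.
pose b := [&& f, p < t & B t j].
have M3 : s3.1 rM = b.
  have C2 : s2.1 rCol = j by rewrite fr.
  have P2 : s2.1 rP = n * n + p * n.+1 by rewrite fr.
  have F2 : s2.1 rF = f by rewrite fr.
  have O2 : s2.1 rOne = 1 by case: r2.
  rewrite /= /upd /= C2 P2 F2 O2 hQ hm //; last by rewrite ltnW.
  rewrite ltnn /= addbF /b subnDl -mulnBl.
  (* The addresses of rows [t] and [p] differ by a multiple of the stride, and truncation turns the
     difference into a comparison of row numbers. *)
  have -> : 1 - (t - p) * n.+1 = ~~ (p < t) by case: ltnP => h; lia.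
  by clear; case: (p < t) f (B t j) => [] [] [].
have r3 : ready n s3 := @ready_den n multiplier _ isT r2.
have P3 : s3.1 rP = n * n + p * n.+1 by rewrite den_frame // fr.
have Q3 : s3.1 rQ = n * n + t * n.+1 by rewrite den_frame.
have h4 : stores n _ s4.2 := xor_rowP pn tn r3 P3 Q3 M3 hm.
change (I t.+1 (ieval (Iadd rQ rQ rS) s4)).
have Q4 : s4.1 rQ = n * n + t * n.+1 by rewrite den_frame.
have S4 : s4.1 rS = n.+1 by rewrite den_frame //; case: r3.
move: s4 Q4 S4 h4 => s4 Q4 S4 h4; split; first by rewrite /= /upd /= Q4 S4 mulSn; lia.
apply: stores_ext h4 => q c qn cn /=.
rewrite !ltnn !andbF !addbF ltnS [q <= t]leq_eqVlt; case: eqP => [-> | //].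
rewrite /b; congr (_ (+) _).
by clear; case: (p < t) f (B t j) => [] [] [].
Qed.

(** Nothing changes until the first 1 of row [p], where the elimination takes place. From then on
    [rFound] is 1, truncation makes [rF] 0, and further passes of [elim_rows] have no effect. *)
Lemma elim_pivotP n B p s : p < n -> ready n s ->
  s.1 rP = n * n + p * n.+1 -> stores n B s.2 ->
  let s' := den elim_pivot s in
  [/\ s'.1 rFound = 0, forall c, c < n -> B p c = false & stores n B s'.2] \/
  s'.1 rFound = 1 /\ exists j, [/\ j < n, B p j & stores n (elim B p j) s'.2].
Proof.
move=> pn rs eP hB; case: (rs) => e0 eN eS e1 eZ.
rewrite /elim_pivot; set loop := For _ _ _.
set s1 := ieval (Iconst rCol 0) (ieval (Iconst rFound 0) s).
pose I t (s : state) := s.1 rCol = t /\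
  ([/\ s.1 rFound = 0, forall c, c < t -> B p c = false & stores n B s.2] \/
  s.1 rFound = 1 /\ exists j, [/\ j < n, B p j & stores n (elim B p j) s.2]).
have N1 : s1.1 rN = n by [].
suff [_] : I (s1.1 rN) (den loop s1) by rewrite N1.
apply: for_rule.
- by move=> t r r' e h [h1 h2]; split; rewrite ?h ?e.
- by split; rewrite /= /upd //=; left.
move=> t s2 tn fr [hC hm].
rewrite N1 in tn.
have {}fr x : x \notin writes loop -> s2.1 x = s.1 x.
  move=> xw; rewrite fr // /= /upd /=.
  by do 2![case: eqP => [e|_]; first by rewrite e in xw].
have r2 : ready n s2 by apply: ready_frame fr isT rs.
have P2 : s2.1 rP = n * n + p * n.+1 by rewrite fr.
have t_le : t <= n by rewrite ltnW.
pose s3 := den test_column s2; pose s4 := den elim_rows s3.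
pose v := s2.2 (n * n + p * n.+1 + t) - s2.1 rFound.
have F3 : s3.1 rF = v by rewrite /= /upd /= P2 hC.
have Fd3 : s3.1 rFound = s2.1 rFound + v by rewrite /= /upd /= P2 hC.
have r3 : ready n s3 := @ready_den n test_column _ isT r2.
have P3 : s3.1 rP = n * n + p * n.+1 by rewrite den_frame.
have C3 : s3.1 rCol = t by rewrite den_frame.
change (I t.+1 (ieval (Iadd rCol rCol rOne) s4)).
have C4 : s4.1 rCol = t by rewrite den_frame.
have O4 : s4.1 rOne = 1 by rewrite den_frame //; case: r3.
have Fd4 : s4.1 rFound = s2.1 rFound + v by rewrite den_frame.
have h4 f B' : v = nat_of_bool f -> stores n B' s2.2 ->
    stores n (fun q c => if f then elim B' p t q c else B' q c) s4.2.
  by move=> vf h; apply: elim_rowsP => //; rewrite F3.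
move: s4 C4 O4 Fd4 h4 => s4 C4 O4 Fd4 h4.
split; first by rewrite /= /upd /= C4 O4 addn1.
case: hm => [[f0 h1 h]|[f1 [j [jn pj h]]]].
  have vE : v = B p t by rewrite /v f0 subn0 h.
  have := h4 _ _ vE h; case E: (B p t) => {}h4.
    by right; split; [rewrite /= /upd /= Fd4 vE f0 E | exists t].
  left; split=> [|c|//]; first by rewrite /= /upd /= Fd4 vE f0 E.
  by rewrite ltnS leq_eqVlt => /predU1P[-> //|]; exact: h1.
have vE : v = false by rewrite /v f1 h //; case: elim.
right; split; first by rewrite /= /upd /= Fd4 f1 vE.
by exists j; split=> //; have := h4 _ _ vE h.
Qed.

(** * Linear systems over F_2 *)

Definition dot n (r x : nat -> bool) : bool := \big[addb/false]_(c < n) (r c && x c).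

(** Only the rows from [p] on count, the earlier ones having been dealt with by the elimination. *)
Definition solvable n (B : nat -> nat -> bool) p : Prop :=
  exists x, forall q, p <= q -> q < n -> dot n (B q) x = B q n.

Lemma eq_dot n r r' x : (forall c, c < n -> r c = r' c) -> dot n r x = dot n r' x.
Proof. by move=> e; apply: eq_bigr => c _; rewrite e. Qed.

Lemma dot_addl n r r' x : dot n (fun c => r c (+) r' c) x = dot n r x (+) dot n r' x.
Proof. by rewrite -big_split; apply: eq_bigr => c _; rewrite andb_addl. Qed.

Lemma dot0 n r x : (forall c, c < n -> r c = false) -> dot n r x = false.
Proof. by move=> r0; apply: big1 => c _; rewrite r0. Qed.

Lemma dot_flip n r x j (e : bool) : j < n ->
  dot n r (fun c => x c (+) ((c == j) && e)) = dot n r x (+) (r j && e).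
Proof.
move=> jn; rewrite (_ : r j && e = \big[addb/false]_(c < n) (r c && ((c == j :> nat) && e))).
  by rewrite -big_split; apply: eq_bigr => c _; rewrite andb_addr.
rewrite (bigD1 (Ordinal jn)) //= eqxx big1 ?addbF // => c.
by rewrite -val_eqE /= => /negPf->; rewrite andbF.
Qed.

Lemma solvable_nopivot n B p : p < n -> (forall c, c < n -> B p c = false) ->
  solvable n B p <-> B p n = false /\ solvable n B p.+1.
Proof.
move=> pn z; split=> [[x hx]|[b0 [x hx]]].
  split; first by rewrite -(hx p) // dot0.
  by exists x => q /ltnW; apply: hx.
exists x => q; rewrite leq_eqVlt => /predU1P[<- _|]; last exact: hx.
by rewrite dot0 // b0.
Qed.

Lemma elim_dot n (B : nat -> nat -> bool) p j q x :
  dot n (elim B p j q) x = dot n (B q) x (+) [&& p < q, B q j & dot n (B p) x].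
Proof.
rewrite dot_addl; congr (_ (+) _).
by case: (p < q); case: (B q j) => //=; apply: dot0.
Qed.

(* A row below p no longer involves x_j, so x_j can be flipped to satisfy row p. *)
Lemma solvable_pivot n (B : nat -> nat -> bool) p j : p < n -> j < n -> B p j ->
  solvable n B p <-> solvable n (elim B p j) p.+1.
Proof.
move=> pn jn pj; split=> [[x hx]|[x hx]].
  by exists x => q pq qn; rewrite elim_dot !hx // ltnW.
(* [e] is the defect of row [p] at [x]; adding it to x_j repairs that row because [B p j] holds. *)
pose e := dot n (B p) x (+) B p n; pose y c := x c (+) ((c == j) && e).
have yp : dot n (B p) y = B p n by rewrite dot_flip // pj /= addKb.
exists y => q; rewrite leq_eqVlt => /predU1P[<- //|pq] qn.
have := hx q pq qn; rewrite elim_dot /elim dot_flip // pq /=.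
(* If [B q j] holds, the flip adds [e] to the left-hand side, which is what passing from
   [elim B p j] back to [B] requires. *)
rewrite /e; case: (B q j) => /=; last by rewrite !addbF.
by rewrite addbA => ->; rewrite -addbA addbb addbF.
Qed.

Lemma elim_allP n B s : ready n s -> stores n B s.2 ->
  (den elim_all s).1 rRej = 0 <-> solvable n B 0.
Proof.
move=> rs hB; case: (rs) => e0 eN eS e1 eZ.
rewrite /elim_all; set loop := For _ _ _.
set s1 := ieval (Iconst rRej 0) (ieval (Iadd rP rL rZero) s).
(* The original system is solvable iff nothing has been rejected so far and the remaining rows of
   the current matrix are solvable. *)
pose I t (s : state) := s.1 rP = n * n + t * n.+1 /\
  exists B', stores n B' s.2 /\ (solvable n B 0 <-> s.1 rRej = 0 /\ solvable n B' t).
have N1 : s1.1 rN = n by [].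
suff [_ [B' [_ ->]]] : I (s1.1 rN) (den loop s1).
  split=> [|[]//] h; split=> //.
  (* After [n] rounds no row remains, so any vector will do. *)
  by exists (fun=> false) => q; rewrite N1 leqNgt => /negPf->.
apply: for_rule.
- by move=> t r r' e h [h1 [B' [h2 h3]]]; split; rewrite ?h ?e //; exists B'.
- split; first by rewrite /= /upd /= e0 eZ.
  by exists B; split => //; split=> [h|[]//]; split.
move=> t s2 tn fr [hP [B' [hB' eq]]].
rewrite N1 in tn.
have {}fr x : x \notin writes loop -> s2.1 x = s.1 x.
  move=> xw; rewrite fr // /= /upd /=.
  by do 2![case: eqP => [e|_]; first by rewrite e in xw].
have r2 : ready n s2 by apply: ready_frame fr isT rs.
pose s3 := den elim_pivot s2; pose s4 := den reject_row s3.
change (I t.+1 (ieval (Iadd rP rP rS) s4)).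
have r3 : ready n s3 := @ready_den n elim_pivot _ isT r2.
have P3 : s3.1 rP = n * n + t * n.+1 by rewrite den_frame.
have R3 : s3.1 rRej = s2.1 rRej by rewrite den_frame.
have cases := elim_pivotP tn r2 hP hB'; rewrite -/s3 in cases.
clearbody s3.
have R4 : s4.1 rRej = s3.1 rRej + (s3.2 (n * n + t * n.+1 + n) - s3.1 rFound).
  by case: r3 => _ n3 _ _ _; rewrite /= /upd /= P3 n3.
have P4 : s4.1 rP = n * n + t * n.+1 by rewrite den_frame.
have S4 : s4.1 rS = n.+1 by rewrite den_frame //; case: r3.
have m4 : s4.2 = s3.2 by [].
clearbody s4.
split; first by rewrite /= /upd /= P4 S4 mulSn; lia.
have -> : (ieval (Iadd rP rP rS) s4).1 rRej = s4.1 rRej by [].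
have -> : (ieval (Iadd rP rP rS) s4).2 = s4.2 by [].
rewrite m4 R4 R3.
case: cases => [[f0 z h]|[f1 [j [jn pj h]]]].
  exists B'; split=> //; rewrite eq solvable_nopivot // f0 h // subn0.
  case: (B' t n); rewrite ?addn0 ?addn1; first by split=> [[_ []]|[]].
  by split=> [[-> []]|[->]].
exists (elim B' t j); split=> //; rewrite eq f1 h //.
by rewrite -solvable_pivot //; case: elim; rewrite addn0.
Qed.

(** * Loading the system *)

(** The two subtractions and the sum into [rDeg] add the copied bit to it over F_2. *)
Definition load_cell : cmd :=
  Iread rV rSrc ;; Iwrite rDst rV ;;
  Isub rW rDeg rV ;; Isub rDeg rV rDeg ;; Iadd rDeg rDeg rW ;;
  Iadd rSrc rSrc rOne ;; Iadd rDst rDst rOne.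

Definition load_entries : cmd :=
  Iconst rDeg 0 ;; For rJ rN load_cell.

(** After [n] copied entries [rDst] points to the right-hand side. Consecutive diagonal cells are
    one stride plus one apart. *)
Definition load_diag : cmd :=
  Isub rW rOne rDeg ;; Iwrite rDst rW ;; Iwrite rDiag rDeg ;;
  Iadd rDst rDst rOne ;; Iadd rDiag rDiag rS ;; Iadd rDiag rDiag rOne.

Definition load : cmd :=
  Iconst rSrc 0 ;; Iadd rDst rL rZero ;; Iadd rDiag rL rZero ;;
  For rI rN (load_entries ;; load_diag).

Definition row_parity (w : nat -> bool) n i t : bool := \big[addb/false]_(c < t) w (i * n + c).

(** The augmented matrix: signs vanish over F_2, and column [n] is 1 + deg. *)
Definition laplacian (w : nat -> bool) n i c : bool :=
  if c == n then ~~ row_parity w n i n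
  else if c == i then row_parity w n i n else w (i * n + c).

Definition input n (w : nat -> bool) (m : nat -> nat) := forall a, a < n * n -> m a = w a.

Lemma input_upd n w m a v : n * n <= a -> input n w m -> input n w (upd m a v).
Proof.
move=> na h x xn; rewrite /upd; case: eqP => [e|_]; last exact: h.
by move: xn; rewrite e ltnNge na.
Qed.

Lemma load_entriesP n w B i s : i < n -> ready n s ->
  s.1 rSrc = i * n -> s.1 rDst = n * n + i * n.+1 -> input n w s.2 -> stores n B s.2 ->
  let s' := den load_entries s in
  [/\ s'.1 rSrc = i * n + n, s'.1 rDst = n * n + i * n.+1 + n,
      s'.1 rDeg = row_parity w n i n, input n w s'.2 &
      stores n (fun q c => if (q == i) && (c < n) then w (i * n + c) else B q c) s'.2].
Proof.
move=> il rs eS eD hw hB; case: (rs) => e0 eN _ e1 _.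
rewrite (_ : den load_entries s = den (For rJ rN load_cell) (ieval (Iconst rDeg 0) s)) //.
cbv zeta; set loop := For _ _ _; set s1 := ieval _ s.
pose I t (s : state) := [/\ s.1 rSrc = i * n + t, s.1 rDst = n * n + i * n.+1 + t,
      s.1 rDeg = row_parity w n i t, input n w s.2 &
      stores n (fun q c => if (q == i) && (c < t) then w (i * n + c) else B q c) s.2].
have N1 : s1.1 rN = n by [].
suff : I (s1.1 rN) (den loop s1) by rewrite N1.
apply: for_rule.
- by move=> t r r' e h [*]; split; rewrite ?h ?e.
- rewrite /I /row_parity big_ord0 !addn0; split=> //.
  by apply: stores_ext hB => q c; rewrite andbF.
move=> t [r m]; rewrite N1 => tn fr [/= hS hD hd hi hm].
have r1 : r rOne = 1 := etrans (fr rOne isT) e1.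
have inp : m (i * n + t) = w (i * n + t).
  have : i.+1 * n <= n * n by rewrite leq_mul2r il orbT.
  by rewrite mulSn => h; rewrite hi //; lia.
split; rewrite /= /upd /= ?hS ?hD ?r1 ?addn1 ?addnS //.
- rewrite hd inp /row_parity big_ord_recr /=.
  by case: (w _) (\big[_/_]_(_ < _) _) => [] [].
- by rewrite inp; apply: input_upd => //; lia.
apply: stores_ext (stores_upd (ltnW tn) (erefl _) inp hm) => q c _ cn.
case: (q =P i) => //= ->; rewrite [c < t.+1]ltnS [c <= t]leq_eqVlt.
by case: (c =P t) => // ->.
Qed.

Lemma loadP n w s : ready n s -> input n w s.2 -> stores n (fun _ _ => false) s.2 ->
  stores n (laplacian w n) (den load s).2.
Proof.
move=> rs hw h0; case: (rs) => e0 eN eS e1 eZ.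
set s1 := den (Iconst rSrc 0 ;; Iadd rDst rL rZero ;; Iadd rDiag rL rZero) s.
rewrite -[den load s]/(den (For rI rN (load_entries ;; load_diag)) s1).
set loop := For _ _ _.
(* Rows from [t] on are still zero, and the input below address n^2 is intact. *)
pose I t (s : state) := [/\ s.1 rSrc = t * n, s.1 rDst = n * n + t * n.+1,
  s.1 rDiag = n * n + t * n.+1 + t, input n w s.2 &
  stores n (fun q c => (q < t) && laplacian w n q c) s.2].
have N1 : s1.1 rN = n by rewrite den_frame.
suff [_ _ _ _ h] : I (s1.1 rN) (den loop s1) by apply: stores_ext h => q c qn _; rewrite N1 qn.
apply: for_rule.
- by move=> t r r' e h [*]; split; rewrite ?h ?e.
- by split; rewrite //= /upd /= e0 eZ ?addn0.
move=> t s2; rewrite N1 => tn fr [hS hD hG hi hm].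
have {}fr x : x \notin writes loop -> s2.1 x = s.1 x.
  move=> xw; rewrite fr // /= /upd /=.
  by do 3![case: eqP => [e|_]; first by rewrite e in xw].
have r2 : ready n s2 by apply: ready_frame fr isT rs.
pose s3 := den load_entries s2.
change (I t.+1 (den load_diag s3)).
have [] := load_entriesP tn r2 hS hD hi hm; rewrite -/s3.
have G3 : s3.1 rDiag = n * n + t * n.+1 + t by rewrite den_frame.
have O3 : s3.1 rOne = 1 by rewrite den_frame //; case: r2.
have S3 : s3.1 rS = n.+1 by rewrite den_frame //; case: r2.
case: s3 G3 O3 S3 => r m /= G3 O3 S3 hS3 hD3 hd3 hi3 hm3.
split; rewrite /= /upd /= ?hS3 ?hD3 ?G3 ?O3 ?S3 ?mulSn; try lia.
  by apply: input_upd; [lia | apply: input_upd; [lia|]].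
have ev : 1 - r rDeg = ~~ row_parity w n t n by rewrite hd3; case: row_parity.
apply: stores_ext (stores_upd (ltnW tn) (erefl _) hd3 (stores_upd (leqnn n) (erefl _) ev hm3)) => q c qn cn.
rewrite /laplacian ltnS [q <= t]leq_eqVlt; case: (q =P t) => //= ->.
have [->|cnn] := eqVneq c n; first by rewrite gtn_eqF.
by rewrite ltn_neqAle cnn cn.
Qed.

(** [rG] is 1 exactly while [rRem] is positive, so [rN] stops at n although the loop makes n^2
    rounds. *)
Definition setup : cmd :=
  Iconst rOne 1 ;; Iconst rZero 0 ;; Iconst rTwo 2 ;;
  Iconst rN 0 ;; Iconst rOdd 1 ;; Iadd rRem rL rZero ;;
  For rI rL (
    Isub rG rOne rRem ;; Isub rG rOne rG ;; Iadd rN rN rG ;;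
    Isub rRem rRem rOdd ;; Iadd rOdd rOdd rTwo) ;;
  Iadd rS rN rOne.

(* n is found by subtracting 1, 3, 5, ... from n^2 *)
Lemma setupP n s : s.1 rL = n * n ->
  let s' := den setup s in ready n s' /\ s'.2 = s.2.
Proof.
move=> e0.
set s1 := den (Iconst rOne 1 ;; Iconst rZero 0 ;; Iconst rTwo 2 ;;
  Iconst rN 0 ;; Iconst rOdd 1 ;; Iadd rRem rL rZero) s.
set loop := For rI rL (
    Isub rG rOne rRem ;; Isub rG rOne rG ;; Iadd rN rN rG ;;
    Isub rRem rRem rOdd ;; Iadd rOdd rOdd rTwo).
rewrite (_ : den setup s = ieval (Iadd rS rN rOne) (den loop s1)) //; cbv zeta.
(* The first t odd numbers add up to t^2; truncation keeps the remainder at 0 from t = n on. *)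
pose I t (s' : state) := [/\ s'.1 rN = minn t n, s'.1 rRem = n * n - t * t,
   s'.1 rOdd = (2 * t).+1 & s'.2 = s.2].
have : I (s1.1 rL) (den loop s1).
  apply: for_rule.
  - by move=> t r r' e h [*]; split; rewrite ?h ?e.
  - by split; rewrite //= /upd /= ?min0n // e0 addn0 subn0.
  move=> t [r m] _ fr [/= hN hR hO hm].
  have r1 : r rOne = 1 := fr rOne isT.
  have r2 : r rTwo = 2 := fr rTwo isT.
  split; rewrite //= /upd /= ?hN ?hR ?hO ?r1 ?r2; try lia.
  by case: (ltnP t n) => h; nia.
have fr x : x \notin writes loop -> (den loop s1).1 x = s1.1 x by apply: den_frame.
have L1 : s1.1 rL = n * n by [].
rewrite L1.
move: (den loop s1) fr => [r m] /= fr [/= hN _ _ hm].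
have nE : r rN = n by rewrite hN; nia.
by split=> //; split; rewrite /= /upd /= ?nE ?fr // addn1.
Qed.

(** * Odd colourings as a linear system *)

Lemma odd_card (T : finType) (A : {set T}) : odd #|A| = \big[addb/false]_x (x \in A).
Proof.
rewrite -sum1_card (big_morph odd oddD (erefl _)) big_mkcond /=.
by apply: eq_bigr => x _; case: ifP.
Qed.

Lemma deg_induced (G : sgraph) (S : {set G}) (u : induced S) :
  deg u = #|[set y in S | adj (val u) y]|.
Proof.
rewrite /deg -(card_imset _ val_inj); apply: eq_card => y; rewrite inE.
apply/imsetP/andP => [[v + ->]|[yS uy]]; first by rewrite inE; split=> //; apply: valP.
by exists (exist _ y yS); rewrite ?inE.
Qed.

(** The degree of [u] inside its class counts its neighbours of the same colour, so a single
    condition covers both classes. *)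
Lemma odd_2_colorableP (G : sgraph) :
  odd_2_colorable G <->
  exists f : G -> bool, forall u, \big[addb/false]_v (adj u v && (f v == f u)).
Proof.
have degE (f : G -> bool) b u :
    odd #|[set y in [set v | f v == b] | adj u y]| = \big[addb/false]_v (adj u v && (f v == b)).
  by rewrite odd_card; apply: eq_bigr => v _; rewrite !inE andbC.
split=> [[V1 [V2 [VU VI o1 o2]]]|[f h]].
  pose f v := v \in V1.
  have fE1 : [set v | f v == true] = V1 by apply/setP => v; rewrite inE eqb_id.
  have fE2 : [set v | f v == false] = V2.
    apply/setP => v; rewrite inE /f eqbF_neg.
    have := in_setT v; rewrite -VU inE; have := in_set0 v; rewrite -VI inE.
    by case: (v \in V1) (v \in V2) => [] [].
  exists f => u; case E: (f u).
    rewrite -degE fE1.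
    by have := o1 (exist _ u E); rewrite deg_induced.
  rewrite -degE fE2.
  have uV2 : u \in V2 by rewrite -fE2 inE E.
  by have := o2 (exist _ u uV2); rewrite deg_induced.
exists [set v | f v == true], [set v | f v == false]; split.
- by apply/setP => v; rewrite !inE; case: (f v).
- by apply/setP => v; rewrite !inE; case: (f v).
- by case=> u uS; rewrite deg_induced degE /=; have := uS; rewrite inE => /eqP {2}<-.
- by case=> u uS; rewrite deg_induced degE /=; have := uS; rewrite inE => /eqP {2}<-.
Qed.

Lemma nth_allpairs (S T R : Type) (f : S -> T -> R) x0 y0 z0 s t i j :
  i < size s -> j < size t ->
  nth z0 [seq f x y | x <- s, y <- t] (i * size t + j) = f (nth x0 s i) (nth y0 t j).
Proof.
move=> + jt; elim: s i => //= x s IH [|i] lti; rewrite nth_cat size_map.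
  by rewrite jt (nth_map y0).
by rewrite mulSn -addnA ltnNge leq_addr /= addKn IH.
Qed.

Lemma nth_encode (G : sgraph) (i j : 'I_#|G|) :
  nth false (encode G) (i * #|G| + j) = adj (enum_val i) (enum_val j).
Proof.
have x0 : G := enum_val i.
rewrite !(enum_val_nth x0) {2}cardE.
by apply: nth_allpairs; rewrite -cardE.
Qed.

Lemma size_encode (G : sgraph) : size (encode G) = #|G| * #|G|.
Proof. by rewrite size_allpairs -cardE. Qed.

(** With no loop at [i], the row is the adjacency row plus the degree parity at position [i]. *)
Lemma dot_laplacian w n i x : i < n -> w (i * n + i) = false ->
  dot n (laplacian w n i) x =
  \big[addb/false]_(c < n) (w (i * n + c) && x c) (+) (row_parity w n i n && x i).
Proof.
move=> il wi; pose d := row_parity w n i n.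
rewrite (@eq_dot _ _ (fun c => w (i * n + c) (+) ((c == i) && d))).
  rewrite dot_addl; congr (_ (+) _).
  rewrite /dot (bigD1 (Ordinal il)) //= eqxx big1 ?addbF // => c.
  by rewrite -val_eqE /= => /negPf->.
move=> c cn; rewrite /laplacian ltn_eqF //; case: eqP => [->|_]; last by rewrite addbF.
by rewrite wi.
Qed.

(* x_v == x_u is 1 + x_u + x_v over F_2, so the parities are linear in x *)
Lemma odd_2_colorable_solvable (G : sgraph) :
  odd_2_colorable G <-> solvable #|G| (laplacian (nth false (encode G)) #|G|) 0.
Proof.
rewrite odd_2_colorableP; set w := nth false _; set n := #|G|.
have key (f : G -> bool) (x : nat -> bool) (i : 'I_n) : (forall c : 'I_n, x c = f (enum_val c)) ->
    (dot n (laplacian w n i) x == laplacian w n i n) =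
    \big[addb/false]_v (adj (enum_val i) v && (f v == f (enum_val i))).
  move=> xf; rewrite dot_laplacian //; last by rewrite /w nth_encode adj_irr.
  rewrite [RHS](reindex _ (onW_bij _ (@enum_val_bij G))) /=.
  rewrite /laplacian eqxx xf.
  have -> : row_parity w n i n = \big[addb/false]_(c < n) adj (enum_val i) (enum_val c).
    by apply: eq_bigr => c _; rewrite /w nth_encode.
  have -> : \big[addb/false]_(c < n) (w (i * n + c) && x c) =
      \big[addb/false]_(c < n) (adj (enum_val i) (enum_val c) && f (enum_val c)).
    by apply: eq_bigr => c _; rewrite /w nth_encode xf.
  (* With S the sum of the colours of the neighbours and d the degree, the equation reads S + d = 1
     + d for colour 1 and S = 1 + d for colour 0. *)
  case: (f (enum_val i)).
    rewrite andbT; under [RHS]eq_bigr do rewrite eqb_id.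
    by move: (\big[_/_]_(_ < _) _) (\big[_/_]_(_ < _) adj _ _) => [] [].
  rewrite andbF addbF.
  rewrite [RHS](_ : _ = (\big[addb/false]_(c < n) adj (enum_val i) (enum_val c)) (+)
    (\big[addb/false]_(c < n) (adj (enum_val i) (enum_val c) && f (enum_val c)))).
    by move: (\big[_/_]_(_ < _) _) (\big[_/_]_(_ < _) adj _ _) => [] [].
  by rewrite -big_split; apply: eq_bigr => c _ /=; case: (adj _ _); case: (f _).
split=> [[f h]|[x h]].
  exists (fun c => if insub c is Some j then f (enum_val (j : 'I_n)) else false) => q _ qn.
  apply/eqP; rewrite (key f _ (Ordinal qn)) // => c.
  by case: insubP => [j _ /val_inj->|]; rewrite ?ltn_ord.
exists (fun v => x (enum_rank v)) => u.
rewrite -[u]enum_rankK -(key _ x); first by apply/eqP; apply: h.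
by move=> c; rewrite enum_valK.
Qed.

(** * The decision program *)

Definition solve : cmd := load ;; elim_all ;; Isub 0 rOne rRej.

(** Register 0 serves as [rL] until the last instruction replaces it by the verdict, positive iff no
    row was rejected. *)
Lemma solveP n w s : ready n s -> input n w s.2 -> stores n (fun _ _ => false) s.2 ->
  0 < (den solve s).1 0 <-> solvable n (laplacian w n) 0.
Proof.
move=> rs hw h0; pose s1 := den load s; pose s2 := den elim_all s1.
have r1 : ready n s1 := @ready_den n load _ isT rs.
have O2 : s2.1 rOne = 1 by rewrite den_frame //; case: r1.
have <- := elim_allP r1 (loadP rs hw h0).
change (0 < (ieval (Isub 0 rOne rRej) s2).1 0 <-> s2.1 rRej = 0).
clearbody s2; rewrite /= /upd /= O2 subn_gt0 ltnS leqn0.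
by split=> [/eqP|/eqP].
Qed.

Theorem theorem3 : polytime_decidable encode odd_2_colorable.
Proof.
exists (compile 0 (setup ;; solve)), (cost (setup ;; solve)) => G.
set n := #|G|; set w := encode G.
pose s0 : state := (upd (fun=> 0) 0 (size w), fun i => nat_of_bool (nth false w i)).
have e0 : s0.1 rL = n * n by rewrite /= /upd /= size_encode.
have [r1 m1] := setupP e0; set s1 := den setup s0 in r1 m1.
have h1 : input n (nth false w) s1.2 by move=> a _; rewrite m1.
have h2 : stores n (fun _ _ => false) s1.2.
  (* The matrix area lies beyond the input word, where [nth] returns its default. *)
  by move=> q c _ _; rewrite m1 /= nth_default // size_encode -addnA leq_addr.
(* Hence the bounds n and n + 1 of [solve] are at most [(size w).+1]. *)
have nn : n <= n * n by case: (n) => [|k] //; rewrite leq_pmulr.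
have [||||t le_t run] := @compile_seq_correct setup solve s0 (size w).
- by [].
- by [].
- by move=> x; rewrite inE => /eqP->; split=> //; rewrite e0 size_encode.
- have [_ N1 S1 _ _] := r1; move=> x.
  have -> : bounds solve = [:: rN; rN; rN; rN; rN; rS] by [].
  rewrite -/s1 !inE => hx; have {hx} [->|->] : x = rN \/ x = rS by lia.
    by rewrite N1 size_encode; split=> //; apply: leqW.
  by rewrite S1 size_encode.
exists t => //; rewrite /init -/w -[Config _ _ _]/(at_pc 0 s0) run.
rewrite halted_at_pc size_compile leqnn accepting_at_pc; split=> //.
by rewrite odd_2_colorable_solvable -(solveP r1 h1 h2).
Qed.
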